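(* Let $M$ be a closed connected surface with a triangulation $\mathcal{T}=\{V,E,F\}$, $V=\{1,\dots,N\}$, let $I:E\to[0,+\infty)$ be an inversive distance, and let $\alpha\in\mathbb{R}$. If $r^*\in\Omega$ is a metric with constant $\alpha$-curvature, then for any nonempty proper subset $A\subset V$, $$2\pi\chi(M)\frac{\sum_{i\in A}(r_i^* )^\alpha}{\|r^*\|_\alpha^\alpha}>-\sum_{(e,v)\in Lk(A)}\big(\pi-\Lambda(I_e)\big)+2\pi\chi(F_A).$$
   Context: $V,E,F$ are the vertices, edges and faces of $\mathcal{T}$, $N=|V|$. For $r\in\mathbb{R}^N_{>0}$ each edge $\{ij\}\in E$ gets length $l_{ij}=\sqrt{r_i^2+r_j^2+2r_ir_jI_{ij}}$. $\Omega$ is the set of all $r\in\mathbb{R}^N_{>0}$ such that for every face $\{ijk\}\in F$ the lengths $l_{ij},l_{jk},l_{ik}$ satisfy the three strict triangle inequalities; elements of $\Omega$ are called (inversive distance circle packing) metrics. For $r\in\Omega$, $\theta_i^{jk}$ is the inner angle at vertex $i$ of the Euclidean triangle $\{ijk\}$ with these edge lengths, and $K_i=2\pi-\sum_{\{ijk\}\in F}\theta_i^{jk}$ (sum over the triangles having $i$ as a vertex). The $\alpha$-curvature at $i$ is $R_{\alpha,i}=K_i/r_i^\alpha$; it is constant if it is the same for all $i\in V$. $\|r\|_\alpha^\alpha=\sum_{i=1}^N r_i^\alpha$. For nonempty proper $A\subset V$: $F_A$ is the subcomplex of $\mathcal{T}$ consisting of all cells whose vertices are all in $A$, and $\chi(F_A)$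 is its Euler characteristic; $Lk(A)$ is the set of pairs $(e,v)$ of an edge $e$ and a vertex $v$ such that (1) the end points of $e$ are not in $A$, (2) $v\in A$, (3) $e$ and $v$ form a triangle of $\mathcal{T}$. $\Lambda(x)=\pi$ for $x\le-1$, $\Lambda(x)=\arccos x$ for $-1\le x\le 1$, $\Lambda(x)=0$ for $x\ge1$. *)

(* Defs.v *)
From HB Require Import structures.
From mathcomp Require Import all_boot all_order all_algebra.
From mathcomp Require Import all_classical all_reals all_analysis.

Set Implicit Arguments.
Unset Strict Implicit.
Unset Printing Implicit Defensive.

Import Order.TTheory GRing.Theory Num.Theory.
Import numFieldNormedType.Exports.

Local Open Scope ring_scope.

(* The graph with vertex set [vs] and adjacency relation [adj] is a
   (simplicial) circle: [c] lists its vertices in cyclic order. *)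
Definition is_circle (T : finType) (vs : {set T}) (adj : rel T) : Prop :=
  exists c : seq T,
    [/\ uniq c, (2 < size c)%N, c =i vs &
        {in c &, forall x y, adj x y = (y == next c x) || (x == next c y)}].

(* A triangulated closed connected surface with vertex set 'I_N: a finite
   connected 2-dimensional simplicial complex in which the link of every vertex
   is a circle. The surface M is the underlying space of the complex. *)
Record triangulation (N : nat) := Triangulation {
  tedges : {set {set 'I_N}};
  tfaces : {set {set 'I_N}};
  tri_vertices_gt0 : (0 < N)%N;
  card_tedge : forall e, e \in tedges -> #|e| = 2;
  card_tface : forall f, f \in tfaces -> #|f| = 3;
  tface_closed : forall e f : {set 'I_N},
    f \in tfaces -> e \subset f -> #|e| = 2 -> e \in tedges;
  tri_link : forall v : 'I_N,
    is_circle [set w : 'I_N | [set v; w] \in tedges]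
              (fun w w' : 'I_N => [set v; w; w'] \in tfaces);
  tri_connected : forall v w : 'I_N,
    connect (fun x y : 'I_N => [set x; y] \in tedges) v w
}.

Section Complexes.
Variables (N : nat) (T : triangulation N).

(* Cells are identified with their vertex sets. *)
Definition cells : {set {set 'I_N}} :=
  [set [set v] | v : 'I_N] :|: tedges T :|: tfaces T.

(* F_A *)
Definition full_subcomplex (A : {set 'I_N}) : {set {set 'I_N}} :=
  [set s in cells | s \subset A].

Definition num_cells (d : nat) (X : {set {set 'I_N}}) : nat :=
  #|[set s in X | #|s| == d.+1]|.

Definition euler_char (X : {set {set 'I_N}}) : int :=
  (num_cells 0 X)%:Z - (num_cells 1 X)%:Z + (num_cells 2 X)%:Z.

Definition Lk (A : {set 'I_N}) : {set {set 'I_N} * 'I_N} :=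
  [set p | [&& p.1 \in tedges T, [disjoint p.1 & A], p.2 \in A &
               p.2 |: p.1 \in tfaces T]].

End Complexes.

Section CirclePacking.
Variables (R : realType) (N : nat) (T : triangulation N).
(* Only the values of [I] on [tedges T] are used. *)
Variable I : {set 'I_N} -> R.
Implicit Type r : 'I_N -> R.

Definition edge_length r (i j : 'I_N) : R :=
  Num.sqrt (r i ^+ 2 + r j ^+ 2 + 2 * r i * r j * I [set i; j]).

Definition is_metric r : Prop :=
  (forall i, 0 < r i) /\
  (forall i j k : 'I_N, [set i; j; k] \in tfaces T ->
    [/\ edge_length r i j < edge_length r j k + edge_length r i k,
        edge_length r j k < edge_length r i j + edge_length r i k &
        edge_length r i k < edge_length r i j + edge_length r j k]).

(* Inner angle at [i] of the Euclidean triangle [ijk], by the law of cosines. *)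
Definition angle r (i j k : 'I_N) : R :=
  acos ((edge_length r i j ^+ 2 + edge_length r i k ^+ 2
           - edge_length r j k ^+ 2)
        / (2 * edge_length r i j * edge_length r i k)).

(* The condition [j < k] makes each triangle at [i] count once. *)
Definition curvature r (i : 'I_N) : R :=
  2 * pi - \sum_(j < N) \sum_(k < N | (j < k)%N && ([set i; j; k] \in tfaces T))
             angle r i j k.

Definition alpha_curvature (alpha : R) r (i : 'I_N) : R :=
  curvature r i / (r i `^ alpha).

Definition constant_alpha_curvature (alpha : R) r : Prop :=
  exists c : R, forall i, alpha_curvature alpha r i = c.

End CirclePacking.

Definition Lambda (R : realType) (x : R) : R :=
  if x <= -1 then pi else if x <= 1 then acos x else 0.

(* Main.v *)
Require Import Defs.
From HB Require Import structures.
From mathcomp Require Import all_boot all_order all_algebra.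
From mathcomp Require Import all_classical all_reals all_analysis.
From mathcomp Require Import ring lra.

Set Implicit Arguments.
Unset Strict Implicit.
Unset Printing Implicit Defensive.

Import Order.TTheory GRing.Theory Num.Theory.
Import numFieldNormedType.Exports.

Local Open Scope ring_scope.

(** Because the alpha-curvature is a constant c, K i = c * r i `^ alpha, and
    Gauss-Bonnet turns the left-hand side into the sum of K over A.  So it
    suffices to show, for any metric with nonnegative inversive distances, that

      sum_(i in A) K i + sum_((e,v) in Lk A) (pi - Lambda (I e)) - 2 pi chi(F_A)

    is positive ([sum_curvature_gt]).

    Every edge lies in exactly two triangles ([edge_in_two_faces]), so both the
    edges and the faces of F_A can be counted triangle by triangle, and the
    quantity above becomes a sum over all triangles of a local excess
    ([curvature_excess]) that depends on how many vertices lie in A: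
    - none: 0;
    - three: pi minus the angle sum of the triangle, which is 0;
    - two: pi minus their two angles, which is the third angle, hence positive;
    - one, say i, opposite to the edge jk: pi - Lambda (I_jk) minus the angle at
      i, which is positive since the inversive distances are nonnegative
      ([circle_packing_cos_gt], [acos_lt_piBLambda]).

    Connectedness gives an edge leaving A, hence a triangle of one of the last
    two kinds, so the sum is positive.  For A = V only the second case occurs,
    and the same identity is the Gauss-Bonnet formula ([gauss_bonnet]).

    To avoid choosing an ordering of each triangle, all sums over triangles are
    sums over ordered triples (i, j, k) weighted by the 0-1 indicator of
    [set i; j; k] being a face; each triangle is then counted six times. *)

(** * Euclidean triangles and circle packings *)

Section TriangleAngles.
Variable R : realType.
Implicit Types x y z : R.

(** Cosine of the angle between the sides [x] and [y], opposite to [z]. *)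
Definition opp_cos x y z : R := (x ^+ 2 + y ^+ 2 - z ^+ 2) / (2 * x * y).

Definition triangle_ineqs x y z : Prop :=
  [/\ z < x + y, x < y + z & y < z + x].

Lemma triangle_ineqs_rot x y z : triangle_ineqs x y z -> triangle_ineqs y z x.
Proof. by case. Qed.

Lemma triangle_sides_gt0 x y z : triangle_ineqs x y z ->
  [/\ 0 < x, 0 < y & 0 < z].
Proof. by move=> [h1 h2 h3]; split; lra. Qed.

Lemma opp_cos_itv x y z : triangle_ineqs x y z -> -1 < opp_cos x y z < 1.
Proof.
move=> txyz; have [x0 y0 z0] := triangle_sides_gt0 txyz.
have [h1 h2 h3] := txyz.
have d0 : 0 < 2 * x * y by rewrite !mulr_gt0.
have p1 : 0 < (x + y - z) * (x + y + z) by rewrite mulr_gt0 //; lra.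
have p2 : 0 < (z - x + y) * (z + x - y) by rewrite mulr_gt0 //; lra.
by rewrite /opp_cos ltr_pdivlMr // ltr_pdivrMr //; apply/andP; split; lra.
Qed.

Lemma opp_cos_itvW x y z : triangle_ineqs x y z -> -1 <= opp_cos x y z <= 1.
Proof. by move=> /opp_cos_itv/andP[h1 h2]; rewrite !ltW. Qed.

(** As [acos] is decreasing and [acos (- u) = pi - acos u], this is the cosine form
    of the fact that two angles of a triangle add up to less than [pi]. *)
Lemma opp_cos_add_gt0 x y z : triangle_ineqs x y z ->
  0 < opp_cos x y z + opp_cos y z x.
Proof.
move=> txyz; have [x0 y0 z0] := triangle_sides_gt0 txyz.
have [h1 h2 h3] := txyz.
have -> : opp_cos x y z + opp_cos y z x
  = (x + z) * (y + x - z) * (y + z - x) / (2 * x * y * z).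
  by rewrite /opp_cos; field; rewrite !lt0r_neq0.
by rewrite divr_gt0 ?mulr_gt0 //; lra.
Qed.

(** By the addition formula the sum of two of the angles has the opposite cosine
    to the third one.  As [cos] is injective only on [[0, pi]], one also needs
    this sum to be at most [pi], which is what [opp_cos_add_gt0] provides. *)
Lemma triangle_angle_sum x y z : triangle_ineqs x y z ->
  acos (opp_cos x y z) + acos (opp_cos y z x) + acos (opp_cos z x y) = pi.
Proof.
move=> txyz; have tyzx := triangle_ineqs_rot txyz.
have tzxy := triangle_ineqs_rot tyzx.
have [x0 y0 z0] := triangle_sides_gt0 txyz; have [h1 h2 h3] := txyz.
have ux := opp_cos_itvW txyz; have uy := opp_cos_itvW tyzx.
have uz := opp_cos_itvW tzxy.
have uyN : -1 <= - opp_cos y z x <= 1 by lra.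
have sum_le : acos (opp_cos x y z) + acos (opp_cos y z x) <= pi.
  rewrite -lerBrDr -acosN // leNgt -ltr_cos ?in_itv /= ?acos_ge0 ?acos_lepi //.
  rewrite !acosK ?in_itv //= -leNgt.
  by have := opp_cos_add_gt0 txyz; lra.
suff : acos (opp_cos x y z) + acos (opp_cos y z x) = acos (- opp_cos z x y).
  by rewrite acosN // => ->; rewrite subrK.
have uzN : -1 <= - opp_cos z x y <= 1 by lra.
apply: cos_inj; rewrite ?in_itv /= ?sum_le ?addr_ge0 ?acos_ge0 ?acos_lepi //.
rewrite cosD !acosK ?in_itv //= !sin_acos // -sqrtrM; last first.
  by rewrite subr_ge0 expr2; nra.
(* Heron: [s16] is 16 times the squared area, and [q] is the product of the
   sines of the two angles. *)
set s16 := (x + y + z) * (x + y - z) * (x + z - y) * (y + z - x).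
have s16_gt0 : 0 < s16 by rewrite /s16 !mulr_gt0 //; lra.
set q := s16 / (4 * x * y ^+ 2 * z).
have q_ge0 : 0 <= q by rewrite divr_ge0 ?ltW // !mulr_gt0 ?exprn_gt0.
have -> : (1 - opp_cos x y z ^+ 2) * (1 - opp_cos y z x ^+ 2) = q ^+ 2.
  by rewrite /q /s16 /opp_cos; field; rewrite !lt0r_neq0.
rewrite sqrtr_sqr ger0_norm // /q /s16 /opp_cos.
by field; rewrite !lt0r_neq0.
Qed.

Lemma acos_opp_cos_gt0 x y z : triangle_ineqs x y z -> 0 < acos (opp_cos x y z).
Proof. by move=> /opp_cos_itv/andP[h1 h2]; rewrite acos_gt0 // ltW. Qed.

(** For [v <= 1], [pi - Lambda v] is [acos (- v)], so the bound is a comparison of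
    cosines; for [v > 1] it is just [pi]. *)
Lemma acos_lt_piBLambda (u v : R) : -1 < u < 1 -> 0 <= v -> - v < u ->
  acos u < pi - Lambda v.
Proof.
move=> /andP[u1 u2] v0 vu; rewrite /Lambda ifF; last by apply/negbTE; lra.
have u12 : -1 <= u <= 1 by rewrite !ltW.
case: (lerP v 1) => [v1|_]; last by rewrite subr0 acos_ltpi // u1 ltW.
have vN : -1 <= - v <= 1 by lra.
have v11 : -1 <= v <= 1 by lra.
rewrite -acosN // -ltr_cos ?in_itv /= ?acos_ge0 ?acos_lepi //.
by rewrite !acosK ?in_itv.
Qed.

(** With [x], [y] the sides at the vertex [i], the claim reads
    [0 < 2 (ri^2 + ri rj a + ri rk b) + 2 c (x y - rj rk)], and nonnegativity of
    [a] and [b] makes [x] exceed [rj] and [y] exceed [rk]. *)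
Lemma circle_packing_cos_gt (ri rj rk a b c : R) :
  0 < ri -> 0 < rj -> 0 < rk -> 0 <= a -> 0 <= b -> 0 <= c ->
  - c < opp_cos (Num.sqrt (ri ^+ 2 + rj ^+ 2 + 2 * ri * rj * a))
                (Num.sqrt (ri ^+ 2 + rk ^+ 2 + 2 * ri * rk * b))
                (Num.sqrt (rj ^+ 2 + rk ^+ 2 + 2 * rj * rk * c)).
Proof.
move=> ri0 rj0 rk0 a0 b0 c0.
have sq0 (s t d : R) : 0 < s -> 0 < t -> 0 <= d ->
    t ^+ 2 < s ^+ 2 + t ^+ 2 + 2 * s * t * d.
  move=> s0 t0 d0; have := exprn_gt0 2 s0.
  have : 0 <= 2 * s * t * d by rewrite !mulr_ge0 // ltW.
  lra.
have lt_side (s t d : R) : 0 < s -> 0 < t -> 0 <= d ->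
    t < @Num.sqrt R (s ^+ 2 + t ^+ 2 + 2 * s * t * d).
  move=> s0 t0 d0; rewrite -[ltLHS]ger0_norm ?ltW // -sqrtr_sqr.
  by rewrite ltr_sqrt ?sq0 // (lt_trans _ (sq0 _ _ _ s0 t0 d0)) ?exprn_gt0.
have sqE (s t d : R) : 0 < s -> 0 < t -> 0 <= d ->
    Num.sqrt (s ^+ 2 + t ^+ 2 + 2 * s * t * d) ^+ 2
    = s ^+ 2 + t ^+ 2 + 2 * s * t * d.
  move=> s0 t0 d0; rewrite sqr_sqrtr // ltW //.
  by rewrite (lt_trans _ (sq0 _ _ _ s0 t0 d0)) ?exprn_gt0.
have hx := lt_side _ _ _ ri0 rj0 a0; have hy := lt_side _ _ _ ri0 rk0 b0.
rewrite /opp_cos !sqE //.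
set x := Num.sqrt (ri ^+ 2 + rj ^+ 2 + 2 * ri * rj * a) in hx *.
set y := Num.sqrt (ri ^+ 2 + rk ^+ 2 + 2 * ri * rk * b) in hy *.
have x0 := lt_trans rj0 hx; have y0 := lt_trans rk0 hy.
rewrite ltr_pdivlMr ?mulr_gt0 //.
have h1 : 0 <= c * (x * y - rj * rk).
  by rewrite mulr_ge0 // subr_ge0 ler_pM // ltW.
have h2 := exprn_gt0 2 ri0.
have h3 : 0 <= ri * rj * a by rewrite !mulr_ge0 // ltW.
have h4 : 0 <= ri * rk * b by rewrite !mulr_ge0 // ltW.
lra.
Qed.

End TriangleAngles.

(** * Sums over subsets as sums over tuples *)

Section TripleSums.
Variables (R : numDomainType) (T : finType).

Lemma sum3_rot (f : T -> T -> T -> R) :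
  \sum_i \sum_j \sum_k f i j k = \sum_i \sum_j \sum_k f j k i.
Proof.
rewrite [RHS]exchange_big /=; apply: eq_bigr => i _.
by rewrite exchange_big.
Qed.

Lemma sum3_cyc (f : T -> T -> T -> R) :
  3 * (\sum_i \sum_j \sum_k f i j k)
  = \sum_i \sum_j \sum_k (f i j k + f j k i + f k i j).
Proof.
rewrite [RHS](_ : _ = \sum_i \sum_j \sum_k f i j k
  + \sum_i \sum_j \sum_k f j k i + \sum_i \sum_j \sum_k f k i j).
  by rewrite -(sum3_rot f) (sum3_rot (fun i j k => f k i j)); ring.
rewrite -!big_split; apply: eq_bigr => i _ /=.
rewrite -!big_split; apply: eq_bigr => j _ /=.
by rewrite -!big_split.
Qed.

Lemma sum3_lincomb (c : R) (f g h : T -> T -> T -> R) :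
  \sum_i \sum_j \sum_k (c * f i j k - g i j k + h i j k)
  = c * (\sum_i \sum_j \sum_k f i j k) - \sum_i \sum_j \sum_k g i j k
    + \sum_i \sum_j \sum_k h i j k.
Proof.
rewrite mulr_sumr -sumrB -big_split; apply: eq_bigr => i _ /=.
rewrite mulr_sumr -sumrB -big_split; apply: eq_bigr => j _ /=.
by rewrite mulr_sumr -sumrB -big_split.
Qed.

Lemma sum_doubletons (G : {set T} -> R) :
  2 * (\sum_(e : {set T} | #|e| == 2) G e)
  = \sum_i \sum_(j | i != j) G [set i; j].
Proof.
rewrite pair_big_dep /= (partition_big (fun p : T * T => [set p.1; p.2])
  (fun e : {set T} => #|e| == 2)) /=; last by move=> [i j] /= nij; rewrite cards2 nij.
rewrite mulr_sumr; apply: eq_bigr => e /cards2P[x [y [nxy ->]]].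
rewrite (bigD1 (x, y)) /= ?nxy ?eqxx // (bigD1 (y, x)) /=; last first.
  by rewrite eq_sym nxy finset.setUC eqxx xpair_eqE negb_and eq_sym nxy.
rewrite big1 ?addr0 ?(finset.setUC [set y]); first by rewrite mulr_natl.
move=> [i j] /= /andP[/andP[/andP[nij /eqP/setP exy]]].
rewrite !xpair_eqE => n1 n2; exfalso; move: (exy i) (exy j).
rewrite !inE !eqxx ?orbT /= => /esym/orP[]/eqP ix /esym/orP[]/eqP jy.
- by rewrite ix jy eqxx in nij.
- by rewrite ix jy !eqxx in n1.
- by rewrite ix jy !eqxx in n2.
- by rewrite ix jy eqxx in nij.
Qed.

(** Each [f] is reached from its three elements [i], with [e = f :\ i]. *)
Lemma sum_tripletons (G : {set T} -> R) :
  3 * (\sum_(f : {set T} | #|f| == 3) G f)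
  = \sum_i \sum_(e : {set T} | (#|e| == 2) && (i \notin e)) G (i |: e).
Proof.
transitivity (\sum_(f : {set T} | #|f| == 3) \sum_(i in f) G f).
  rewrite mulr_sumr; apply: eq_bigr => f /eqP f3.
  by rewrite sumr_const f3 mulr_natl.
rewrite (exchange_big_dep xpredT) //=; apply: eq_bigr => i _.
rewrite (reindex_onto (fun e => i |: e) (fun f => f :\ i)) /=; last first.
  by move=> f /andP[_ fi]; rewrite finset.setD1K.
apply: eq_bigl => e; rewrite cardsU1 finset.setU11 andbT.
have [ie|nie] := boolP (i \in e) => /=.
  by rewrite andbF; apply/negbTE/negP => /andP[_ /eqP/setP/(_ i)]; rewrite !inE eqxx ie.
by rewrite finset.setU1K // eqxx !andbT.
Qed.

End TripleSums.

(** * Counting the cells of a full subcomplex through its triangles *)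

Section Surface.
Variables (N : nat) (T : triangulation N).
Notation F := (tfaces T).
Notation E := (tedges T).

Lemma face_uniq (i j k : 'I_N) : [set i; j; k] \in F ->
  [/\ i != j, i != k & j != k].
Proof.
move=> /card_tface; rewrite finset.setUC cardsU1 cards2 !inE negb_or.
by rewrite (eq_sym k i) (eq_sym k j); do 3 case: (_ != _).
Qed.

Lemma edge_neq (i j : 'I_N) : [set i; j] \in E -> i != j.
Proof. by move=> /card_tedge; rewrite cards2; case: (_ != _). Qed.

Lemma face_edge (i j k : 'I_N) : [set i; j; k] \in F -> [set i; j] \in E.
Proof.
move=> f; have [nij _ _] := face_uniq f.
by apply: (tface_closed f); rewrite ?finset.subsetUl // cards2 nij.
Qed.

Lemma set3_rot (i j k : 'I_N) : [set i; j; k] = [set j; k; i] :> {set 'I_N}.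
Proof. by rewrite -finset.setUA finset.setUC. Qed.

Lemma set3_swap (i j k : 'I_N) : [set i; j; k] = [set i; k; j] :> {set 'I_N}.
Proof. by rewrite finset.setUAC. Qed.

(** The third vertices of the triangles through [ij] are the neighbours of [j] in
    the link of [i], and in a circle of length at least 3 the successor and the
    predecessor of [j] are distinct. *)
Lemma edge_in_two_faces (i j : 'I_N) :
  #|[set k | [set i; j; k] \in F]| = (([set i; j] \in E) * 2)%N.
Proof.
have [eij|neij] := boolP ([set i; j] \in E); last first.
  rewrite mul0n; apply: eq_card0 => k; rewrite !inE.
  by apply/negP => /face_edge; rewrite (negbTE neij).
have [c [uc c2 cE adjE]] := tri_link T i.
have jc : j \in c by rewrite cE inE.
have nxt : next c j != prev c j.
  apply/eqP => /(congr1 (next c)); rewrite next_prev //.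
  case/rot_to: (jc) => n p rot_c.
  have := size_rot n c; rewrite -!(next_rot n uc) rot_c.
  have : uniq (j :: p) by rewrite -rot_c rot_uniq.
  case: p {rot_c} => [|a [|b p]] /= + sz; rewrite -?sz in c2 => //.
  rewrite !inE !eqxx !negb_or => /andP[/and3P[nja njb _] _].
  by rewrite (eq_sym a) (negbTE nja) => bj; rewrite bj eqxx in njb.
rewrite (_ : [set k | _] = [set next c j; prev c j]) ?cards2 ?nxt //.
apply/setP => k; rewrite !inE; apply/idP/idP.
  move=> f; have kc : k \in c.
    by rewrite cE inE; apply: (@face_edge i k j); rewrite set3_swap.
  move: (adjE j k jc kc); rewrite f => /esym/orP[->//|/eqP->].
  by rewrite prev_next ?eqxx ?orbT.
move=> h; have kc : k \in c by move: h => /orP[]/eqP->; rewrite ?mem_next ?mem_prev.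
rewrite adjE //; case/orP: h => /eqP->; rewrite ?eqxx // next_prev //.
by rewrite eqxx orbT.
Qed.

Variables (R : numDomainType) (A : {set 'I_N}).
Notation t i j k := (([set i; j; k] \in F)%:R : R).
Notation a i := ((i \in A)%:R : R).

Lemma sum_faces_at_edge (i j : 'I_N) :
  \sum_k t i j k = ([set i; j] \in E)%:R * 2.
Proof.
rewrite -natrM -edge_in_two_faces -sum1_card natr_sum [RHS]big_mkcond /=.
by apply: eq_bigr => k _; rewrite inE; case: (_ \in _).
Qed.

Lemma num_vertices_full : num_cells 0 (full_subcomplex T A) = #|A|.
Proof.
rewrite /num_cells -[RHS](card_imset _ (@finset.set1_inj _)); apply: eq_card => s.
rewrite !inE; apply/andP/imsetP => [[/andP[_ sA] /cards1P[v sv]]|[v vA ->]].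
  by exists v; rewrite // -finset.sub1set -sv.
by rewrite cards1 finset.sub1set vA imset_f.
Qed.

Lemma mem_cells_card2 (s : {set 'I_N}) : #|s| = 2 -> (s \in cells T) = (s \in E).
Proof.
move=> s2; rewrite !inE; case: imsetP => [[v _ sv]|_].
  by rewrite sv cards1 in s2.
case: (boolP (s \in F)) => [/card_tface|_]; first by rewrite s2.
by rewrite orbF.
Qed.

Lemma mem_cells_card3 (s : {set 'I_N}) : #|s| = 3 -> (s \in cells T) = (s \in F).
Proof.
move=> s2; rewrite !inE; case: imsetP => [[v _ sv]|_].
  by rewrite sv cards1 in s2.
by case: (boolP (s \in E)) => [/card_tedge|_]; first by rewrite s2.
Qed.

(** Besides the two orientations of an edge, the factor 4 accounts for the two
    triangles containing it. *)
Lemma num_edges_full :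
  4 * (num_cells 1 (full_subcomplex T A))%:R
  = \sum_i \sum_j \sum_k t i j k * (a i * a j).
Proof.
rewrite /num_cells -sum1_card natr_sum.
rewrite (eq_bigl (fun s : {set 'I_N} => (#|s| == 2) && ((s \in E) && (s \subset A)))).
  rewrite big_mkcondr /= (_ : 4 = 2 * 2); last by rewrite -natrM.
  rewrite -mulrA sum_doubletons mulr_sumr; apply: eq_bigr => i _.
  rewrite big_mkcond mulr_sumr; apply: eq_bigr => j _.
  rewrite -mulr_suml sum_faces_at_edge finset.subUset !finset.sub1set.
  case: (boolP (_ \in E)) => [/edge_neq->|_]; last by rewrite /= if_same; ring.
  by case: (_ \in A); case: (_ \in A) => /=; ring.
move=> s; rewrite inE andbC inE; apply: andb_id2l => /eqP s2.
by rewrite mem_cells_card2.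
Qed.

Lemma num_faces_full :
  6 * (num_cells 2 (full_subcomplex T A))%:R
  = \sum_i \sum_j \sum_k t i j k * (a i * a j * a k).
Proof.
rewrite /num_cells -sum1_card natr_sum.
rewrite (eq_bigl (fun s : {set 'I_N} => (#|s| == 3) && ((s \in F) && (s \subset A)))).
  rewrite big_mkcondr /= (_ : 6 = 2 * 3); last by rewrite -natrM.
  rewrite -mulrA sum_tripletons mulr_sumr; apply: eq_bigr => i _.
  rewrite big_mkcondr sum_doubletons; apply: eq_bigr => j _.
  rewrite big_mkcond; apply: eq_bigr => k _.
  rewrite finset.setUA !finset.subUset !finset.sub1set !inE.
  case: (boolP (_ \in F)) => [/face_uniq[nij nik njk]|_] /=;
    last by rewrite !if_same mul0r.
  rewrite njk negb_or nij nik.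
  by case: (_ \in A); case: (_ \in A); case: (_ \in A) => /=; ring.
move=> s; rewrite inE andbC inE; apply: andb_id2l => /eqP s3.
by rewrite mem_cells_card3.
Qed.

Lemma sum_Lk (g : {set 'I_N} -> R) :
  2 * (\sum_(p in Lk T A) g p.1)
  = \sum_i \sum_j \sum_k t i j k * (a i * (1 - a j) * (1 - a k) * g [set j; k]).
Proof.
transitivity (2 * (\sum_(i in A) \sum_(e : {set 'I_N} | #|e| == 2)
    if (i |: e \in F) && [disjoint e & A] then g e else 0)).
  congr (_ * _).
  under [RHS]eq_bigr do rewrite -big_mkcondr.
  rewrite [RHS](exchange_big_dep xpredT) //= pair_big_dep /=.
  apply: eq_bigl => -[e i]; rewrite !inE /=.
  apply/and4P/and4P => [[eE eA iA ief]|[iA e2 ief eA]].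
    by rewrite (card_tedge eE).
  split=> //; apply: (tface_closed ief); rewrite ?finset.subsetUr //; exact/eqP.
rewrite mulr_sumr big_mkcond /=; apply: eq_bigr => i _.
rewrite sum_doubletons.
case: (i \in A); last by rewrite big1 // => j _; rewrite big1 // => k _ /=; ring.
apply: eq_bigr => j _; rewrite big_mkcond; apply: eq_bigr => k _.
rewrite finset.setUA finset.disjoints_subset finset.subUset !finset.sub1set !inE.
case: (boolP (_ \in F)) => [/face_uniq[nij nik njk]|_] /=;
  last by rewrite !if_same mul0r.
rewrite njk.
by case: (_ \in A); case: (_ \in A) => /=; ring.
Qed.

(** Otherwise [A] would be closed under adjacency. *)
Lemma ex_mixed_face :
  A != finset.set0 -> A != [set: 'I_N]%SET ->
  exists i j k, [/\ [set i; j; k] \in F, i \in A & j \notin A].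
Proof.
move=> /set0Pn[v vA] nT.
have [w wA] : exists w, w \notin A.
  apply/existsP; apply: contraNT nT; rewrite negb_exists => /forallP h.
  by apply/eqP/setP => x; rewrite inE; have := h x; rewrite negbK.
have [i [j [eij iA jA]]] : exists i j,
    [/\ [set i; j] \in E, i \in A & j \notin A].
  apply: contrapT => h; move: wA.
  rewrite -(@closed_connect _ _ A _ _ _ (tri_connected T v w)) ?vA //.
  move=> x y exy; apply/idP/idP => m; apply: contrapT => /negP n; apply: h.
    by exists x, y.
  by exists y, x; rewrite finset.setUC.
have : (0 < #|[set k | [set i; j; k] \in F]|)%N
  by rewrite edge_in_two_faces eij.
by case/card_gt0P => k; rewrite inE => f; exists i, j, k.
Qed.

End Surface.

(** * Curvature as a sum of local excesses *)

Section Curvature.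
Variables (R : realType) (N : nat) (T : triangulation N).
Variables (I : {set 'I_N} -> R) (r : 'I_N -> R).
Notation F := (tfaces T).
Notation E := (tedges T).
Notation len := (edge_length I r).
Notation ang := (angle I r).
Notation K := (curvature T I r).
Notation t i j k := (([set i; j; k] \in F)%:R : R).

Lemma edge_lengthC i j : len i j = len j i.
Proof. by rewrite /edge_length finset.setUC; congr Num.sqrt; ring. Qed.

Lemma angleC i j k : ang i j k = ang i k j.
Proof. by rewrite /angle (edge_lengthC k j); congr acos; congr (_ / _); ring. Qed.

Lemma metric_triangle_ineqs i j k : is_metric T I r -> [set i; j; k] \in F ->
  triangle_ineqs (len i j) (len i k) (len j k).
Proof.
by move=> [_ H] /H[h1 h2 h3]; split; lra.
Qed.

Lemma face_angle_sum i j k : is_metric T I r -> [set i; j; k] \in F ->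
  ang i j k + ang j k i + ang k i j = pi.
Proof.
move=> m f; rewrite -(triangle_angle_sum (metric_triangle_ineqs m f)).
rewrite -addrA [_ + ang k i j]addrC addrA (angleC k) (angleC j).
rewrite /angle /opp_cos !(edge_lengthC k) (edge_lengthC j i).
congr (_ + _ + _); congr acos; congr (_ / _); ring.
Qed.

Lemma face_angle_gt0 i j k : is_metric T I r -> [set i; j; k] \in F ->
  0 < ang i j k.
Proof. by move=> m f; apply/acos_opp_cos_gt0/metric_triangle_ineqs. Qed.

Lemma face_angle_lt i j k : (forall e, e \in E -> 0 <= I e) ->
  is_metric T I r -> [set i; j; k] \in F ->
  ang i j k < pi - Lambda (I [set j; k]).
Proof.
move=> I0 m f; have [r0 _] := m.
have Iij : 0 <= I [set i; j] by apply/I0/face_edge/f.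
have Iik : 0 <= I [set i; k].
  by apply: I0; apply: (@face_edge _ _ i k j); rewrite set3_swap.
have Ijk : 0 <= I [set j; k].
  by apply: I0; apply: (@face_edge _ _ j k i); rewrite -set3_rot.
apply: acos_lt_piBLambda => //; first exact/opp_cos_itv/metric_triangle_ineqs.
exact: circle_packing_cos_gt.
Qed.

(** Dropping the condition [j < k] counts each triangle at [i] twice. *)
Lemma sum_angles_at i :
  2 * \sum_(j < N) \sum_(k < N | (j < k)%N && ([set i; j; k] \in F)) ang i j k
  = \sum_j \sum_k t i j k * ang i j k.
Proof.
pose u (j k : 'I_N) : R := (j < k)%N%:R * (t i j k * ang i j k).
transitivity (\sum_j \sum_k u j k + \sum_j \sum_k u j k).
  rewrite mulr_natl mulr2n; congr (_ + _); apply: eq_bigr => j _;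
  rewrite big_mkcond; apply: eq_bigr => k _;
  by rewrite /u; case: (j < k)%N; case: (_ \in F); rewrite ?mul1r ?mul0r.
rewrite [X in _ + X]exchange_big -big_split; apply: eq_bigr => j _ /=.
rewrite -big_split; apply: eq_bigr => k _ /=; rewrite /u (set3_swap i k) (angleC i k).
case: (boolP (_ \in F)) => [/face_uniq[_ _ njk]|_]; last by rewrite /=; ring.
by case: (ltngtP j k) => [_|_|/val_inj jk] /=; [ring|ring|rewrite jk eqxx in njk].
Qed.

Section Subset.
Variable A : {set 'I_N}.
Notation a i := ((i \in A)%:R : R).
Let g e := pi - Lambda (I e).

Lemma sum_curvature :
  2 * (\sum_(i in A) K i)
  = 4 * pi * #|A|%:R - \sum_i \sum_j \sum_k t i j k * (a i * ang i j k).
Proof.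
rewrite -sum1_card natr_sum !mulr_sumr [in RHS]big_mkcond [LHS]big_mkcond /=.
rewrite -sumrB; apply: eq_bigr => i _; case: (i \in A) => /=; last first.
  by rewrite big1 ?subr0 // => j _; rewrite big1 // => k _; rewrite mul0r mulr0.
rewrite mulrBr sum_angles_at; congr (_ - _); first by ring.
by apply: eq_bigr => j _; apply: eq_bigr => k _; rewrite mul1r.
Qed.

(** The contribution of a triangle, with [a] the indicator of [A], written so as to
    be invariant under rotation of the vertices.  The first two terms come from
    the edges and the face of F_A, the next from the angles and the last from the
    link of [A]. *)
Definition face_excess i j k : R :=
  pi * (a i * a j + a j * a k + a k * a i) - 2 * pi * (a i * a j * a k)
  - (a i * ang i j k + a j * ang j k i + a k * ang k i j)
  + (a i * (1 - a j) * (1 - a k) * g [set j; k]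
     + a j * (1 - a k) * (1 - a i) * g [set k; i]
     + a k * (1 - a i) * (1 - a j) * g [set i; j]).

(** The vertex terms cancel between the curvatures and chi(F_A).  The terms that
    single out one vertex or one edge of the ordered triangle are then averaged
    over its three rotations. *)
Lemma curvature_excess :
  6 * (\sum_(i in A) K i + \sum_(p in Lk T A) g p.1
       - 2 * pi * (euler_char (full_subcomplex T A))%:~R)
  = \sum_i \sum_j \sum_k t i j k * face_excess i j k.
Proof.
have SK := sum_curvature; have SL := sum_Lk T A g.
have SE := num_edges_full T R A; have SF := num_faces_full T R A.
rewrite /euler_char num_vertices_full !(intrD, rmorphN) /=.
transitivity (3 * (\sum_i \sum_j \sum_k t i j k *
   (pi * (a i * a j) - a i * ang i j k
    + a i * (1 - a j) * (1 - a k) * g [set j; k]))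
   - 2 * pi * \sum_i \sum_j \sum_k t i j k * (a i * a j * a k)).
  have -> : \sum_i \sum_j \sum_k t i j k *
      (pi * (a i * a j) - a i * ang i j k
       + a i * (1 - a j) * (1 - a k) * g [set j; k])
    = pi * (4 * (num_cells 1 (full_subcomplex T A))%:R)
      - (4 * pi * #|A|%:R - 2 * \sum_(i in A) K i)
      + 2 * \sum_(p in Lk T A) g p.1.
    have -> : 4 * pi * #|A|%:R - 2 * \sum_(i in A) K i
      = \sum_i \sum_j \sum_k t i j k * (a i * ang i j k) by rewrite SK; ring.
    rewrite SE SL -sum3_lincomb; apply: eq_bigr => i _.
    by apply: eq_bigr => j _; apply: eq_bigr => k _; ring.
  rewrite -SF; ring.
rewrite sum3_cyc mulr_sumr -sumrB; apply: eq_bigr => i _.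
rewrite mulr_sumr -sumrB; apply: eq_bigr => j _.
rewrite mulr_sumr -sumrB; apply: eq_bigr => k _.
rewrite -(set3_rot i j k) (set3_rot k i j) /face_excess; ring.
Qed.

Lemma face_excess_ge0 i j k : (forall e, e \in E -> 0 <= I e) ->
  is_metric T I r -> [set i; j; k] \in F -> 0 <= face_excess i j k.
Proof.
move=> I0 m f; have sum_ang := face_angle_sum m f.
have fj : [set j; k; i] \in F by rewrite -set3_rot.
have fk : [set k; i; j] \in F by rewrite -2!set3_rot.
have := face_angle_gt0 m f; have := face_angle_gt0 m fj.
have := face_angle_gt0 m fk; have := face_angle_lt I0 m f.
have := face_angle_lt I0 m fj; have := face_angle_lt I0 m fk.
rewrite /face_excess -!/(g _).
by case: (i \in A); case: (j \in A); case: (k \in A) => /=; lra.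
Qed.

Lemma face_excess_gt0 i j k : (forall e, e \in E -> 0 <= I e) ->
  is_metric T I r -> [set i; j; k] \in F -> i \in A -> j \notin A ->
  0 < face_excess i j k.
Proof.
move=> I0 m f iA jA; have sum_ang := face_angle_sum m f.
have fj : [set j; k; i] \in F by rewrite -set3_rot.
have fk : [set k; i; j] \in F by rewrite -2!set3_rot.
rewrite /face_excess iA (negbTE jA); case: (k \in A) => /=.
  have := face_angle_gt0 m fj; lra.
have := face_angle_lt I0 m f; rewrite -/(g _); lra.
Qed.

End Subset.

(** The excess of every triangle with respect to the whole vertex set is [pi]
    minus its angle sum, and the link of the whole vertex set is empty. *)
Lemma gauss_bonnet : is_metric T I r ->
  \sum_i K i = 2 * pi * (euler_char (cells T))%:~R.
Proof.
move=> m; have full : full_subcomplex T finset.setT = cells T.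
  by apply/setP => s; rewrite inE finset.subsetT andbT.
have LkT : Lk T finset.setT = finset.set0.
  apply/setP => p; rewrite [RHS]inE; apply/negbTE/negP.
  rewrite inE => /and4P[eE + _ _].
  have /eqP/cards2P[x [y [_ ->]]] := card_tedge eE.
  by rewrite finset.disjoints_subset finset.subUset finset.sub1set !inE.
have := curvature_excess finset.setT; rewrite full LkT big_set0 addr0.
rewrite [RHS]big1 => [h|i _]; last first.
  rewrite big1 // => j _; rewrite big1 // => k _.
  case: (boolP (_ \in _)) => [f|_]; last by rewrite mul0r.
  by have := face_angle_sum m f; rewrite /face_excess !inE /=; lra.
have {h} : \sum_(i in finset.setT) K i = 2 * pi * (euler_char (cells T))%:~R by lra.
by under eq_bigl do rewrite inE.
Qed.

Lemma sum_curvature_gt (A : {set 'I_N}) : is_metric T I r ->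
  (forall e, e \in E -> 0 <= I e) ->
  A != finset.set0 -> A != [set: 'I_N]%SET ->
  - (\sum_(p in Lk T A) (pi - Lambda (I p.1)))
    + 2 * pi * (euler_char (full_subcomplex T A))%:~R < \sum_(i in A) K i.
Proof.
move=> m I0 A0 AT; have [i [j [k [f iA jA]]]] := ex_mixed_face T A0 AT.
have ge0 i' j' k' : 0 <= ([set i'; j'; k'] \in F)%:R * face_excess A i' j' k'.
  by case: (boolP (_ \in _)) => [/(face_excess_ge0 A I0 m)|_]; rewrite ?mul0r // mul1r.
have : 0 < 6 * (\sum_(i in A) K i + \sum_(p in Lk T A) (pi - Lambda (I p.1))
       - 2 * pi * (euler_char (full_subcomplex T A))%:~R).
  rewrite curvature_excess (bigD1 i) //= (bigD1 j) //= (bigD1 k) //= f mul1r.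
  have ge0_2 i' j' : 0 <= \sum_k ([set i'; j'; k] \in F)%:R
      * face_excess A i' j' k by apply: sumr_ge0.
  apply: ltr_wpDr; first by apply: sumr_ge0 => i' _; apply: sumr_ge0.
  apply: ltr_wpDr; first by apply: sumr_ge0.
  apply: ltr_wpDr; first by apply: sumr_ge0.
  exact: (face_excess_gt0 I0 m f iA jA).
lra.
Qed.

End Curvature.

Theorem corollary7p2 (R : realType) (N : nat) (T : triangulation N)
  (I : {set 'I_N} -> R) (I_ge0 : forall e, e \in tedges T -> 0 <= I e)
  (alpha : R) (r : 'I_N -> R) (r_metric : is_metric T I r)
  (r_const : constant_alpha_curvature T I alpha r)
  (A : {set 'I_N}) (A_nonempty : A != finset.set0)
  (A_proper : A != [set: 'I_N]%SET) :
  2 * pi * (euler_char (cells T))%:~R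
    * ((\sum_(i in A) r i `^ alpha) / (\sum_(i < N) r i `^ alpha))
  > - (\sum_(p in Lk T A) (pi - Lambda (I p.1)))
    + 2 * pi * (euler_char (full_subcomplex T A))%:~R.
Proof.
have [c Kc] := r_const; have [r0 _] := r_metric.
have KE i : curvature T I r i = c * r i `^ alpha.
  by rewrite -(Kc i) /alpha_curvature divfK // gt_eqF // powR_gt0.
have S0 : 0 < \sum_(i < N) r i `^ alpha.
  rewrite (bigD1 (Ordinal (tri_vertices_gt0 T))) //=.
  by rewrite ltr_pwDl ?powR_gt0 // sumr_ge0 // => i _; exact: powR_ge0.
have := sum_curvature_gt r_metric I_ge0 A_nonempty A_proper.
rewrite -(gauss_bonnet r_metric).
rewrite (eq_bigr _ (fun i _ => KE i)) [in X in _ -> X](eq_bigr _ (fun i _ => KE i)).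
by rewrite -!mulr_sumr mulrACA divff ?mulr1 // gt_eqF.
Qed.
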